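(* For each $a\in[0,\infty]$ there exist a continuum $Y$ and a homeomorphism $g\colon Y\to Y$ with $h_{\mathrm{pol}}(g)=a$.
   Context: A continuum is a nonempty compact connected metric space. Polynomial entropy of a continuous selfmap $f$ of a compact metric space $(X,d)$: $S\subseteq X$ is $(n,\varepsilon,f)$-separated if $\max_{0\le i\le n-1}d(f^i(x),f^i(y))>\varepsilon$ for any distinct $x,y\in S$; $\mathrm{sep}(n,\varepsilon,f)$ is the maximal cardinality of an $(n,\varepsilon,f)$-separated subset of $X$; $h_{\mathrm{pol}}(f)=\lim_{\varepsilon\to0}\limsup_{n\to\infty}\frac{\log\mathrm{sep}(n,\varepsilon,f)}{\log n}\in[0,\infty]$. *)

(* Defs.v *)
From mathcomp Require Import all_boot all_order all_algebra.
From mathcomp Require Import all_classical all_reals all_analysis.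

Set Implicit Arguments.
Unset Strict Implicit.
Unset Printing Implicit Defensive.

Import Order.TTheory GRing.Theory Num.Theory.
Import numFieldTopology.Exports.

Local Open Scope classical_set_scope.
Local Open Scope ring_scope.

Definition continuum (R : realType) (Y : metricType R) : Prop :=
  [/\ [set: Y] !=set0, compact [set: Y] & connected [set: Y]].

Definition homeomorphism (X Y : topologicalType) (g : X -> Y) : Prop :=
  continuous g /\ exists h, [/\ continuous h, cancel g h & cancel h g].

Section polynomial_entropy.
Context {R : realType} {X : metricType R}.
Implicit Types (f : X -> X) (n : nat) (e : R) (S : set X).

(* Distances are nonnegative, so the default value 0 only matters when n = 0. *)
Definition bowen_dist f n (x y : X) : R :=
  \big[Num.max/0]_(i < n) mdist (iter i f x) (iter i f y).

Definition separated f n e S : Prop :=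
  forall x y, S x -> S y -> x <> y -> e < bowen_dist f n x y.

(* [counting S] is the cardinality of S, equal to +oo when S is infinite. On a
   compact space with f continuous and 0 < e, the cardinalities of separated
   sets are bounded, so that this supremum is a maximum. *)
Definition sep f n e : \bar R :=
  ereal_sup [set counting S | S in separated f n e].

(* The terms n = 0 and n = 1, where the quotient is degenerate, do not affect
   the limit superior. *)
Definition pol_growth f e : \bar R :=
  limn_esup (fun n => lne (sep f n e) / (ln n%:R)%:E)%E.

Definition hpol f : \bar R := lim (pol_growth f e @[e --> 0^'+]).

Lemma le_sep f n e1 e2 : e1 <= e2 -> (sep f n e2 <= sep f n e1)%E.
Proof.
move=> e12; apply: ge_ereal_sup => _ [S sepS <-].
apply: ereal_sup_ubound; exists S => // x y Sx Sy xy.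
exact: le_lt_trans e12 (sepS x y Sx Sy xy).
Qed.

Lemma sep_ge0 f n e : (0 <= sep f n e)%E.
Proof.
by apply: ereal_sup_ubound; exists set0 => //; rewrite /counting asboolT// fset_set0.
Qed.

Lemma le_pol_growth f e1 e2 :
  e1 <= e2 -> (pol_growth f e2 <= pol_growth f e1)%E.
Proof.
move=> e12; rewrite /pol_growth !limn_esup_lim.
apply: lee_lim; [exact: is_cvg_esups|exact: is_cvg_esups|].
exists 2%N => // k /= k2.
apply: ge_ereal_sup => _ [n /= kn <-].
have n1 : (1 < n)%N by exact: leq_trans kn.
have ln0 : 0 < ln n%:R :> R by rewrite ln_gt0// ltr1n.
apply: (@le_trans _ _ (lne (sep f n e1) / (ln n%:R)%:E)%E); last first.
  by apply: ereal_sup_ubound; exists n.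
rewrite inver gt_eqF// lee_wpmul2r//; first by rewrite lee_fin invr_ge0 ltW.
by rewrite lee_lne ?in_itv/= ?sep_ge0 ?leey// le_sep.
Qed.

(* The limit defining [hpol] always exists. *)
Lemma is_cvg_pol_growth f : cvg (pol_growth f e @[e --> 0^'+]).
Proof.
apply: nonincreasing_at_right_is_cvge; near=> b => x y _ _ xy.
exact: le_pol_growth.
Unshelve. all: by end_near. Qed.

End polynomial_entropy.

(* Main.v *)
(* A point of the space records the trajectories of a sequence of points turning
   on circles of common radius s <= 1, the j-th one at constant speed al_j in a
   compact set A_j; the homeomorphism is the time shift, and letting s go to 0
   connects everything. Two trajectories become distinguishable before time n
   when their speeds differ by about 1/n, while s and the initial angles only
   contribute factors independent of n. Hence sep(n, e) grows like the number
   of (1/n)-separated speeds (al_j), j < m(e), and the polynomial entropy is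
   the sum of the box dimensions of the A_j. Taking for d of the A_j the Cantor
   set of ratio exp(-lam), of dimension ln 2 / lam, and {0} for the others
   gives every finite value; infinitely many Cantor sets give +oo. *)

From HB Require Import structures.
Require Import Defs.
From mathcomp Require Import all_boot all_order all_algebra.
From mathcomp Require Import all_classical all_reals all_analysis.
From mathcomp Require Import ring lra zify.

Set Implicit Arguments.
Unset Strict Implicit.
Unset Printing Implicit Defensive.

Import Order.TTheory GRing.Theory Num.Theory.
Import numFieldNormedType.Exports.

Local Open Scope classical_set_scope.
Local Open Scope ring_scope.

(** * Counting separated sets and passing to the growth rate *)

Section separated_sets.
Context {R : realType} {X : metricType R}.
Implicit Types (f : X -> X) (n : nat) (e : R).

Lemma le_bowen_dist f n i x y : (i < n)%N ->
  mdist (iter i f x) (iter i f y) <= bowen_dist f n x y.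
Proof.
move=> lein; exact: (le_bigmax_cond _ (j := Ordinal lein)
  (fun i : 'I_n => mdist (iter i f x) (iter i f y))).
Qed.

Lemma bowen_dist_le f n x y e : 0 <= e ->
  (forall i, (i < n)%N -> mdist (iter i f x) (iter i f y) <= e) ->
  bowen_dist f n x y <= e.
Proof. by move=> e0 h; apply: bigmax_le => // i _; exact: h. Qed.

Lemma bowen_distxx f n x : bowen_dist f n x x = 0.
Proof. by apply: bigmax_eq_id => i _; rewrite mdistxx. Qed.

(** Pigeonhole: two points of a separated set never share a code, so [code] embeds the set into
    [T]. *)
Lemma sep_le_card f n e (T : finType) (code : X -> T) :
  (forall x y, code x = code y -> bowen_dist f n x y <= e) ->
  (sep f n e <= #|T|%:R%:E)%E.
Proof.
move=> h; apply: ge_ereal_sup => _ [S sepS <-].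
pose rk x := enum_rank (code x) : nat.
have inj : {in S &, injective rk}.
  move=> x y /set_mem Sx /set_mem Sy /ord_inj/enum_rank_inj/h.
  by apply: contraPP => xy; apply/negP; rewrite -ltNge; exact: sepS.
have SI : (S #<= `I_#|T|)%card.
  rewrite -(card_le_eql (inj_card_eq inj)); apply: subset_card_le.
  by move=> _ [x _ <-] /=; exact: ltn_ord.
have finS : finite_set S by apply: card_le_finite SI (finite_II _).
by rewrite /counting asboolT// lee_fin ler_nat; exact: geq_card_fset_set.
Qed.

Lemma sep_ge_card f n e (T : finType) (p : T -> X) : 0 <= e ->
  (forall t u, t != u -> e < bowen_dist f n (p t) (p u)) ->
  (#|T|%:R%:E <= sep f n e)%E.
Proof.
move=> e0 h.
have inj : injective p.
  move=> t u ptu; apply/eqP/negPn/negP => /h.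
  by rewrite ptu bowen_distxx ltNge e0.
apply: (@le_trans _ _ (counting (range p))); last first.
  apply: ereal_sup_ubound; exists (range p) => //.
  by move=> _ _ [t _ <-] [u _ <-] tu; apply: h; apply/eqP => /(congr1 p).
have fin : finite_set (range p) by exact: finite_image.
rewrite /counting asboolT// lee_fin ler_nat.
rewrite cardE -(size_map p); apply: uniq_leq_size.
  by rewrite map_inj_uniq// enum_uniq.
by move=> _ /mapP[t _ ->]; rewrite in_fset_set//; apply/mem_set; exists t.
Qed.

Let nat_ln_ge (M : R) : exists N, forall k, (N <= k)%N ->
  (1 < k)%N /\ M <= ln k%:R.
Proof.
exists (maxn 2 (Num.truncn (expR M)).+1) => k; rewrite geq_max => /andP[k1 Mk].
have k0 : (0 < k)%N by exact: leq_trans k1.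
split=> //; rewrite -ler_expR lnK; last by rewrite posrE ltr0n.
by apply: (le_trans (ltW (truncnS_gt _))); rewrite ler_nat.
Qed.

(** A factor [expR C] independent of [n] adds only [C / ln n] to the quotient, and this is at most
    [d] once [ln n >= C / d]. *)
Lemma pol_growth_le f e (a C : R) :
  (forall n, (1 < n)%N -> (sep f n e <= (expR (C + a * ln n%:R))%:E)%E) ->
  (pol_growth f e <= a%:E)%E.
Proof.
move=> h; rewrite /pol_growth limn_esup_lim; apply/lee_addgt0Pr => d d0.
apply: lime_le; first exact: is_cvg_esups.
have [N hN] := nat_ln_ge (C / d); exists N => // n /= Nn.
apply: ge_ereal_sup => _ [k /= nk <-].
have [k1 hk] := hN k (leq_trans Nn nk).
have lnk : 0 < ln k%:R :> R by rewrite ln_gt0// ltr1n.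
rewrite inver gt_eqF// lee_pdivrMr//.
rewrite -lee_expeR lneK; last by rewrite in_itv/= sep_ge0 leey.
apply: le_trans (h _ k1) _; rewrite -EFinD -EFinM/= lee_fin ler_expR.
by rewrite mulrDl addrC lerD2l -ler_pdivrMl// mulrC.
Qed.

Lemma pol_growth_ge f e (a C : R) (N : nat) :
  (forall n, (N <= n)%N -> ((expR (a * ln n%:R - C))%:E <= sep f n e)%E) ->
  (a%:E <= pol_growth f e)%E.
Proof.
move=> h; rewrite /pol_growth limn_esup_lim; apply/lee_subgt0Pr => d d0.
apply: lime_ge; first exact: is_cvg_esups.
have [M hM] := nat_ln_ge (C / d); exists (maxn N M) => // n /=.
rewrite geq_max => /andP[Nn /hM[n1 hn]].
have lnn : 0 < ln n%:R :> R by rewrite ln_gt0// ltr1n.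
apply: (@le_trans _ _ (lne (sep f n e) / (ln n%:R)%:E)%E); last first.
  by apply: ereal_sup_ubound; exists n => /=.
rewrite inver gt_eqF// lee_pdivlMr//.
rewrite -lee_expeR lneK; last by rewrite in_itv/= sep_ge0 leey.
apply: le_trans (h _ Nn); rewrite -EFinB -EFinM/= lee_fin ler_expR.
by rewrite mulrBl lerD2l lerN2 -ler_pdivrMl// mulrC.
Qed.


Lemma hpol_le f (a : \bar R) :
  (forall e, 0 < e -> (pol_growth f e <= a)%E) -> (hpol f <= a)%E.
Proof.
move=> h; apply: lime_le; first exact: is_cvg_pol_growth.
by near=> e; apply: h; near: e; exact: nbhs_right_gt.
Unshelve. all: by end_near. Qed.

(** By monotonicity in the scale, the growth at one scale already bounds the limit at 0 from
    below. *)
Lemma hpol_ge f e (a : \bar R) : 0 < e ->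
  (a <= pol_growth f e)%E -> (a <= hpol f)%E.
Proof.
move=> e0 h; apply: lime_ge; first exact: is_cvg_pol_growth.
near=> d; apply: (le_trans h); apply: le_pol_growth.
by near: d; exact: nbhs_right_le.
Unshelve. all: by end_near. Qed.

End separated_sets.

(** * Coordinates of a rotating point *)

Section oscillation.
Context {R : realType}.
Implicit Types (t u : R) (c : bool).

(* The two real coordinates of exp(i pi t). *)
Definition osc c t : R := if c then cos (pi * t) else sin (pi * t).

Lemma normr_osc c t : `|osc c t| <= 1.
Proof. by case: c; [exact: cos_max|exact: sin_max]. Qed.

Let lip1 (f df : R -> R) : (forall x : R, is_derive x 1 f (df x)) ->
  (forall x, `|df x| <= 1) -> forall x y, `|f x - f y| <= `|x - y|.
Proof.
move=> fdf df1; suff H x y : x <= y -> `|f y - f x| <= `|y - x|.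
  move=> x y; have [/H|/ltW/H//] := leP x y.
  by rewrite distrC [in leRHS]distrC.
move=> xy; have [|c _ ->] := @MVT_segment _ f df x y xy.
- apply: continuous_subspaceT => z; apply: differentiable_continuous.
  by apply/derivable1_diffP; apply: ex_derive.
- by rewrite normrM -[leRHS]mul1r ler_wpM2r.
Qed.

Lemma osc_lipschitz c t u : `|osc c t - osc c u| <= 4 * `|t - u|.
Proof.
have pi4 : pi <= 4 :> R by have := @pihalf_lt2 R; lra.
apply: (@le_trans _ _ `|pi * t - pi * u|).
  case: c; rewrite /osc.
    by apply: (@lip1 cos (fun x => - sin x)) => x; rewrite ?normrN ?sin_max.
  by apply: (@lip1 sin cos) => x; rewrite ?cos_max.
by rewrite -mulrBr normrM ger0_norm ?pi_ge0// ler_wpM2r.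
Qed.

Lemma osc_periodic c t : osc c (t + 2) = osc c t.
Proof.
rewrite /osc mulrDr (_ : pi * 2 = pi *+ 2); last by rewrite mulr_natr.
by rewrite sinD2pi cosD2pi.
Qed.

(** Angles between a quarter and a half turn apart have a difference of nonpositive cosine. The
    squared chord [2 - 2 cos (a - b)] is then at least 2, so one of the two coordinates contributes
    at least 1. *)
Lemma osc_apart t u : 2^-1 <= `|t - u| <= 1 ->
  exists c, 1 <= `|osc c t - osc c u|.
Proof.
move=> /andP[h1 h2]; apply/not_existsP => h.
have sq1 (x : R) : `|x| < 1 -> x ^+ 2 < 1.
  by rewrite ltr_norml => /andP[]; nra.
have /negP := h true; have /negP := h false; rewrite /osc -!ltNge.
move=> /sq1 + /sq1.
set a := pi * t; set b := pi * u.
have := cosB a b; have := cos2Dsin2 a; have := cos2Dsin2 b.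
have : cos (a - b) <= 0.
  rewrite -cos_norm /a /b -mulrBr normrM ger0_norm ?pi_ge0//.
  rewrite -oppr_ge0 -[X in 0 <= - X]opprK.
  have -> : cos (pi * `|t - u|) = - sin (pi * `|t - u| - pi / 2).
    by rewrite sinBpihalf opprK.
  rewrite !opprK; apply: sin_ge0_pi.
  by have := @pi_gt0 R; nra.
nra.
Qed.

End oscillation.

(** * The Cantor set of ratio [r] and its finite codes *)

Section cantor_set.
Context {R : realType} (r : R).
Hypothesis r0 : 0 < r.
Hypothesis r4 : r <= 1 / 4.
Implicit Types b : seq bool.

(** The sum of [(1 - r) r ^ i] over the positions [i] of [true] in [b]: the left endpoint of the
    construction interval with address [b]. Missing digits count as [false]. *)
Fixpoint cantor_pt b : R :=
  if b is x :: b' then r * cantor_pt b' + (if x then 1 - r else 0) else 0.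

Definition cantor := closure (range cantor_pt).

Let cantor_ptE b :
  cantor_pt b = r * cantor_pt (behead b) + (if head false b then 1 - r else 0).
Proof. by case: b => //=; rewrite mulr0 addr0. Qed.

Lemma cantor_pt_itv b : 0 <= cantor_pt b <= 1.
Proof. elim: b => [|x b /andP[b0 b1]] /=; first by lra.
have /andP[rb0 rb1] : 0 <= r * cantor_pt b <= r.
  by rewrite mulr_ge0 ?(ltW r0)//= ler_piMr ?(ltW r0).
by case: x => /=; move: r0 r4; lra. Qed.

(** Each common leading digit contracts the distance by [r], starting from two points of the unit
    interval. *)
Lemma cantor_pt_close L b b' :
  (forall i, (i < L)%N -> nth false b i = nth false b' i) ->
  `|cantor_pt b - cantor_pt b'| <= r ^+ L.
Proof.
elim: L b b' => [|L IH] b b' h.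
  have := cantor_pt_itv b; have := cantor_pt_itv b'.
  by rewrite expr0 ler_norml; lra.
rewrite cantor_ptE [cantor_pt b']cantor_ptE -!nth0 (h 0)//.
rewrite opprD addrACA subrr addr0.
rewrite -mulrBr normrM gtr0_norm// exprS ler_pM2l//; apply: IH => i iL.
by rewrite !nth_behead h.
Qed.

(** At the first differing digit the points lie in the pieces [[0, r]] and [[1 - r, 1]], whose gap
    is at least 1/2 since [r <= 1 / 4]; the earlier common digits scale this by fewer than [L]
    factors [r]. Equal lengths matter, as trailing [false] digits do not move the point. *)
Lemma cantor_pt_apart L b b' : size b = L -> size b' = L -> b != b' ->
  r ^+ L / 2 <= `|cantor_pt b - cantor_pt b'|.
Proof.
elim: b b' L => [|x b IH] [|x' b'] [|L] //= [bL] [b'L].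
have rL : 0 <= r ^+ L <= 1.
  by rewrite exprn_ge0 ?exprn_ile1 ?(ltW r0)//; move: r4; lra.
have Ib := cantor_pt_itv b; have Ib' := cantor_pt_itv b'.
have [<-|xx' _] := eqVneq x x'.
  rewrite eqseq_cons eqxx/= => /(IH _ L bL b'L) {}IH.
  rewrite opprD addrACA subrr addr0 -mulrBr normrM gtr0_norm//.
  by rewrite exprS -mulrA ler_pM2l.
have /andP[rb0 rb1] : 0 <= r * cantor_pt b <= r.
  by case/andP: Ib => ? ?; rewrite mulr_ge0 ?(ltW r0)//= ler_piMr ?(ltW r0).
have /andP[rb0' rb1'] : 0 <= r * cantor_pt b' <= r.
  by case/andP: Ib' => ? ?; rewrite mulr_ge0 ?(ltW r0)//= ler_piMr ?(ltW r0).
have rrL : r * r ^+ L <= r by case/andP: rL => ? ?; rewrite ler_piMr ?(ltW r0).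
rewrite exprS ler_normr; case: x x' xx' => -[]//= _; apply/orP;
  [left|right]; move: r0 r4; lra.
Qed.

Lemma cantor_cantor_pt b : cantor (cantor_pt b).
Proof. by apply: subset_closure; exists b. Qed.

Lemma cantor_itv : cantor `<=` `[0, 1].
Proof.
have /closure_id -> : closed `[0, 1 : R] by exact: itv_closed.
apply: closure_subset.
by move=> _ [b _ <-] /=; rewrite in_itv/=; exact: cantor_pt_itv.
Qed.

Lemma compact_cantor : compact cantor.
Proof.
apply: (subclosed_compact _ (@segment_compact _ 0 1)); last exact: cantor_itv.
exact: closed_closure.
Qed.

Lemma cantor_code L : exists code : R -> L.-tuple bool,
  forall x y, cantor x -> cantor y -> code x = code y -> `|x - y| <= 3 * r ^+ L.
Proof.
have rL : 0 < r ^+ L by rewrite exprn_gt0.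
have /choice[b hb] : forall x, exists b,
    cantor x -> `|x - cantor_pt b| <= r ^+ L.
  move=> x; have [xK|] := pselect (cantor x); last by exists [::].
  have [_ [[b _ <-] /ltW xb]] := xK _ (nbhsx_ballx x _ rL).
  by exists b.
(* The code keeps the first [L] digits of a nearby finite word. The three errors [r ^ L] come from
   the two approximations and from the unread digits. *)
exists (fun x => [tuple nth false (b x) i | i < L]) => x y /hb xb /hb yb.
move=> /(congr1 (fun t : L.-tuple bool => tnth t)) exy.
have := @cantor_pt_close L (b x) (b y).
have -> : x - y = (x - cantor_pt (b x)) + (cantor_pt (b x) - cantor_pt (b y))
   - (y - cantor_pt (b y)) by ring.
move=> h; apply: (le_trans (ler_normB _ _)).
apply: (le_trans (lerD (ler_normD _ _) yb)).
rewrite [leRHS](_ : _ = r ^+ L + r ^+ L + r ^+ L); last by ring.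
rewrite lerD2r; apply: lerD => //; apply: h => i iL.
by have := congr1 (fun t => t (Ordinal iL)) exy; rewrite /= !tnth_mktuple.
Qed.

End cantor_set.
(* The index (j, i, c) stands for the c-th coordinate (cosine or sine), at time
   i, of the j-th rotating point. *)
Definition idx := (nat * int * bool)%type.

(** * The metric space of trajectories *)

Section waves.
Context {R : realType}.
Implicit Types (s t : R) (th al : nat -> R) (k : idx).

(** The decay in the circle index leaves finitely many circles relevant at a given scale; the decay
    in time lets a shift by [d] change weights by a factor at most [2 ^ |d|]. *)
Definition weight k : R := 2^-1 ^+ (k.1.1 + `|k.1.2|).

(** Angles are in units of pi. The radius [s] is common to all circles, so that [s = 0] collapses
    everything to one point. *)
Definition wave s th al k : R := s * osc k.2 (th k.1.1 + k.1.2%:~R * al k.1.1).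

Definition is_wave (A : nat -> set R) (x : idx -> R) := exists s th al,
  [/\ 0 <= s <= 1, forall j, A j (al j) & x = wave s th al].

(** Points are the trajectories themselves rather than their parameters, so all parameters with
    [s = 0] are identified. *)
Definition waves (A : nat -> set R) := {x : idx -> R | is_wave A x}.

HB.instance Definition _ A := gen_eqMixin (waves A).
HB.instance Definition _ A := gen_choiceMixin (waves A).

Lemma weight_gt0 k : 0 < weight k.
Proof. by rewrite exprn_gt0// invr_gt0. Qed.

Lemma weight_le1 k : weight k <= 1.
Proof. by rewrite exprn_ile1 ?invr_ge0// invf_le1// ler1n. Qed.

Section distance.
Context (A : nat -> set R).
Implicit Types x y z : waves A.

Lemma waves_inj x y : (forall k, sval x k = sval y k) -> x = y.
Proof. by case: x y => [x hx] [y hy] /= xy; apply: eq_exist; exact: funext. Qed.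

Lemma normr_waves x k : `|sval x k| <= 1.
Proof.
have [s [th [al [/andP[s0 s1] _ ->]]]] := svalP x.
by rewrite normrM -[leRHS]mulr1 ler_pM ?normr_osc// ger0_norm.
Qed.

Definition wdist x y : R :=
  sup (range (fun k => weight k * `|sval x k - sval y k|)).

Let wterm_le2 x y k : `|sval x k - sval y k| <= 2.
Proof.
by rewrite (le_trans (ler_normB _ _))// -[2](@natrD _ 1 1) lerD// normr_waves.
Qed.

Lemma le_wdist x y k : weight k * `|sval x k - sval y k| <= wdist x y.
Proof.
apply: ub_le_sup; last by exists k.
exists 2 => _ [l _ <-]; rewrite -[leRHS]mul1r.
by rewrite ler_pM ?wterm_le2 ?weight_le1// ltW// weight_gt0.
Qed.

Lemma wdist_le x y (e : R) :
  (forall k, weight k * `|sval x k - sval y k| <= e) -> wdist x y <= e.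
Proof.
move=> h; apply: ge_sup; last by move=> _ [k _ <-].
pose k0 : idx := (0%N, 0, true).
by exists (weight k0 * `|sval x k0 - sval y k0|), k0.
Qed.

Let wdistxx x : wdist x x = 0.
Proof.
apply/eqP; rewrite eq_le wdist_le/=; last first.
  by move=> k; rewrite subrr normr0 mulr0.
by apply: le_trans (le_wdist x x (0%N, 0, true)); rewrite subrr normr0 mulr0.
Qed.

Let wdist_positivity x y : wdist x y = 0 -> x = y.
Proof.
move=> xy0; apply: waves_inj => k; apply/eqP; rewrite -subr_eq0 -normr_le0.
by rewrite -(pmulr_rle0 _ (weight_gt0 k)) -xy0 le_wdist.
Qed.

Let wdist_sym x y : wdist x y = wdist y x.
Proof. by congr sup; apply: eq_imagel => k _; rewrite distrC. Qed.

Let wdist_triangle y x z : wdist x z <= wdist x y + wdist y z.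
Proof.
apply: wdist_le => k; apply: le_trans (lerD (le_wdist x y k) (le_wdist y z k)).
by rewrite -mulrDr ler_pM2l ?weight_gt0// ler_distD.
Qed.

HB.instance Definition _ := isMetric.Build R (waves A)
  wdistxx wdist_positivity wdist_sym wdist_triangle.

Lemma mdist_waves_le x y (e : R) :
  (forall k, weight k * `|sval x k - sval y k| <= e) -> mdist x y <= e.
Proof. exact: wdist_le. Qed.

Lemma le_mdist_waves x y k : weight k * `|sval x k - sval y k| <= mdist x y.
Proof. exact: le_wdist. Qed.

End distance.
End waves.

(** * The time shift as a homeomorphism *)

Section dynamics.
Context {R : realType} (A : nat -> set R).
Implicit Types (x y : waves A) (k : idx) (d : int).

(** Waiting for time [d] only advances the initial angles by [d] times the speeds; radius and speeds
    stay. *)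
Lemma is_wave_shift d (x : waves A) :
  is_wave A (fun k => sval x (k.1.1, k.1.2 + d, k.2)).
Proof.
have [s [th [al [hs hal ->]]]] := svalP x.
exists s, (fun j => th j + d%:~R * al j), al; split=> //.
by apply/funext => k; rewrite /wave/= intrD mulrDl addrA addrAC.
Qed.

Definition shift d x : waves A := exist _ _ (is_wave_shift d x).

Lemma shiftK d : cancel (shift d) (shift (- d)).
Proof. by move=> x; apply: waves_inj => -[[j i] c] /=; rewrite subrK. Qed.

Lemma iter_shift1 n x k :
  sval (iter n (shift 1) x) k = sval x (k.1.1, k.1.2 + n%:Z, k.2).
Proof.
elim: n k => [|n IH] [[j i] c] /=; first by rewrite addr0.
by rewrite IH/= intS addrA.
Qed.

Lemma mdist_shift d x y :
  mdist (shift d x) (shift d y) <= 2 ^+ `|d| * mdist x y.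
Proof.
apply: mdist_waves_le => -[[j i] c] /=.
apply: le_trans (ler_wpM2l _ (le_mdist_waves x y (j, i + d, c))); last first.
  by rewrite exprn_ge0.
rewrite mulrA ler_wpM2r// /weight/= !exprVn ler_pdivlMr ?exprn_gt0//.
by rewrite ler_pdivrMl ?exprn_gt0// -exprD ler_weXn2l ?ler1n//; lia.
Qed.

Lemma continuous_shift d : continuous (shift d).
Proof.
move=> x; apply/(@metricType_numDomainType.cvgrPdist_lt
  R (waves A) (waves A) (nbhs x)) => e e0.
have d0 : 0 < 2 ^+ `|d| :> R by rewrite exprn_gt0.
apply: filterS (nbhsx_ballx x _ (divr_gt0 e0 d0)) => y.
rewrite ballEmdist/= => xy; apply: le_lt_trans (mdist_shift _ _ _) _.
by rewrite -ltr_pdivlMl// mulrC.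
Qed.

Lemma homeomorphism_shift d : homeomorphism (shift d).
Proof.
split; first exact: continuous_shift.
exists (shift (- d)); split; [exact: continuous_shift|exact: shiftK|].
by rewrite -{2}(opprK d); exact: shiftK.
Qed.

End dynamics.

(** * Parametrization, compactness and connectedness *)

Section parametrization.
Context {R : realType} (A : nat -> set R).
Implicit Types (s t e : R) (th al : nat -> R) (k : idx) (x y : waves A).

Lemma osc_periodicz c t (m : int) : osc c (t + 2 * m%:~R) = osc c t.
Proof.
have per n (u : R) : osc c (u + 2 * n%:R) = osc c u.
  elim: n u => [|n IH] u; first by rewrite mulr0 addr0.
  by rewrite -[n.+1]addn1 natrD mulrDr mulr1 addrA osc_periodic IH.
case: m => n; first exact: per.
by rewrite NegzE -[RHS](per n.+1) mulrNz mulrN -{1}(per n.+1) subrK.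
Qed.

(** Reducing the initial angles modulo a full turn puts them in a compact interval. *)
Lemma wavesE x : exists s th al, [/\ 0 <= s <= 1, forall j, 0 <= th j <= 2,
  forall j, A j (al j) & sval x = wave s th al].
Proof.
have [s [th [al [s01 Aal ->]]]] := svalP x.
exists s, (fun j => th j + 2 * (- Num.floor (th j / 2))%:~R), al.
split => // [j|].
  have := floor_itv (th j / 2); rewrite mulrNz intrD => /andP[]; lra.
by apply/funext => k; rewrite /wave addrAC osc_periodicz.
Qed.

(** Circles of index at least [m] have weight at most [2 ^- m] and coordinates at most 2 apart. On
    the others the radius costs [u] and the angle [4 (u + (|i| + n) v)], where the weight turns
    [|i| + n] into at most [n + 1]. The case [n = 0] serves for continuity, general [n] for
    counting. *)
Lemma waves_close m n s s' th th' al al' (u v e : R) x y :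
  0 <= s <= 1 -> 0 <= s' <= 1 ->
  sval x = wave s th al -> sval y = wave s' th' al' ->
  `|s - s'| <= u ->
  (forall j, (j < m)%N -> `|th j - th' j| <= u /\ `|al j - al' j| <= v) ->
  2 / 2 ^+ m <= e -> 5 * u + 4 * n.+1%:R * v <= e ->
  mdist (iter n (shift 1) x) (iter n (shift 1) y) <= e.
Proof.
move=> s01 s01' xE yE su mu me ue; apply: mdist_waves_le => -[[j i] c].
rewrite !iter_shift1 /=.
have [jm|mj] := ltnP j m; last first.
  apply: le_trans me; rewrite mulrC; apply: ler_pM => //.
  - by rewrite exprn_ge0.
  - rewrite (le_trans (ler_normB _ _))// -[2](@natrD _ 1 1).
    by rewrite lerD ?normr_waves.
  - rewrite /weight/= exprVn lef_pV2 ?posrE ?exprn_gt0//.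
    by rewrite ler_weXn2l ?ler1n// (leq_trans mj)// leq_addr.
have [thu alv] := mu j jm; rewrite xE yE /wave/=.
set o := osc c _; set o' := osc c _.
have oo : `|o - o'| <= 4 * (u + (`|i| + n)%:R * v).
  apply: le_trans (osc_lipschitz _ _ _) _; rewrite ler_pM2l//.
  rewrite opprD addrACA -mulrBr; apply: le_trans (ler_normD _ _) _.
  rewrite lerD// normrM ler_pM//.
  rewrite -intr_norm -[X in _ <= X]/((`|i| + n)%N%:Z%:~R) ler_int.
  lia.
(* The weights absorb the time coordinate: |i| / 2 ^ |i| <= 1. *)
have w1 : weight (j, i, c) * (`|i| + n)%:R <= n.+1%:R :> R.
  rewrite /weight/= exprVn mulrC ler_pdivrMr ?exprn_gt0//.
  rewrite -natrX -natrM ler_nat.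
  have := ltn_expl `|i| (ltnSn 1).
  have := leq_pexp2l (ltn0Sn 1) (leq_addl j `|i|).
  by move: (2 ^ _)%N (2 ^ _)%N => p q; nia.
(* This separates the change of radius from the change of angle. *)
have -> : s * o - s' * o' = (s - s') * o + s' * (o - o') by ring.
have w0 : 0 <= weight (j, i, c) :> R by rewrite ltW// weight_gt0.
have w2 : weight (j, i, c) <= 1 :> R := weight_le1 _.
have o1 : `|(s - s') * o| <= u.
  by rewrite normrM -[leRHS]mulr1 ler_pM// normr_osc.
have o2 : `|s' * (o - o')| <= 4 * (u + (`|i| + n)%:R * v).
  case/andP: s01' => s0 s1; apply: le_trans oo.
  by rewrite normrM ger0_norm// ler_piMl.
apply: (@le_trans _ _ (weight (j, i, c) * (u + 4 * (u + (`|i| + n)%:R * v)))).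
  by rewrite ler_wpM2l// (le_trans (ler_normD _ _))// lerD.
apply: le_trans ue.
have u0 : 0 <= u by exact: le_trans su.
have v0 : 0 <= v by exact: le_trans alv.
have := ler_wpM2r v0 w1.
have := ler_piMl u0 w2.
move: (weight _) => w; move: (_%:R) (_%:R) => p q; nra.
Qed.

Local Notation triple := (R * {ptws nat -> R} * {ptws nat -> R})%type.

(** The default [x0] makes the map total on a product space; only its restriction to admissible
    triples matters. *)
Definition mk_wave (x0 : waves A) (p : triple) : waves A :=
  xget x0 [set x | sval x = wave p.1.1 p.1.2 p.2].

Lemma mk_waveE x0 s th al : 0 <= s <= 1 -> (forall j, A j (al j)) ->
  sval (mk_wave x0 (s, th, al)) = wave s th al.
Proof.
move=> s01 Aal; have h : is_wave A (wave s th al).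
  by exists s, th, al.
rewrite /mk_wave; case: xgetP => [y -> //|/(_ (exist _ _ h))].
by case.
Qed.

Lemma waves_inhabited : (forall j, A j !=set0) -> exists x : waves A, True.
Proof.
move=> /choice[al Aal]; have h : is_wave A (wave 0 al al).
  by exists 0, al, al; split => //; rewrite lexx ler01.
by exists (exist _ _ h).
Qed.

Let params : set triple :=
  `[0, 1]%classic `*` [set th | forall j, `[0, 2]%classic (th j)] `*`
  [set al | forall j, A j (al j)].

Lemma exists_exp2_le e : 0 < e -> exists m, 2 / 2 ^+ m <= e.
Proof.
move=> e0; have e20 : 0 < e / 2 by rewrite divr_gt0.
have [m _ /(_ m (leqnn m))] := near_infty_natSinv_expn_lt (PosNum e20).
by move=> /= /ltW h; exists m; lra.
Qed.

(** Up to [e], a trajectory depends only on the radius and on the angles and speeds of the first [m]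
    circles, which are finitely many coordinates of the product. *)
Let mk_wave_continuous x0 : {within params, continuous (mk_wave x0)}.
Proof.
apply/subspace_continuousP => -[[s th] al] /= [[/= s01 _] Aal].
apply/metricType_numDomainType.cvgrPdist_lt => e e0.
have e20 : 0 < e / 2 by rewrite divr_gt0.
have [m me] := exists_exp2_le e20.
(* With [u = v = e / 18] and [n = 0], the bound [5 u + 4 v] is [e / 2]. *)
have e18 : 0 < e / 18 by rewrite divr_gt0.
pose p0 : triple := (s, th, al).
have FF : Filter (nbhs p0) by exact: nbhs_filter.
have near_coord (f : triple -> R) :
    {for p0, continuous f} -> \forall q \near p0, `|f p0 - f q| <= e / 18.
  by move=> /cvgrPdist_le; exact.
have near_s : \forall q \near p0, `|s - q.1.1| <= e / 18.
  apply: (near_coord (fun q => q.1.1)).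
  by apply: (cvg_comp fst fst); exact: cvg_fst.
have near_th (j : 'I_m) :
    \forall q \near p0, `|th j - (q.1.2 : nat -> R) j| <= e / 18.
  apply: (near_coord (fun q => q.1.2 j)).
  apply: (@cvg_comp _ _ _ (snd \o fst) (proj (nat_of_ord j)) _
    (nbhs (th : {ptws nat -> R}))).
    by apply: (cvg_comp fst snd); [exact: cvg_fst|exact: cvg_snd].
  exact: (@proj_continuous nat (fun=> R) j th).
have near_al (j : 'I_m) :
    \forall q \near p0, `|al j - (q.2 : nat -> R) j| <= e / 18.
  apply: (near_coord (fun q => q.2 j)).
  apply: (@cvg_comp _ _ _ snd (proj (nat_of_ord j)) _
    (nbhs (al : {ptws nat -> R}))).
    exact: cvg_snd.
  exact: (@proj_continuous nat (fun=> R) j al).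
rewrite near_withinE.
have near_ths := @filter_forall _ _ _ _ FF near_th.
have near_als := @filter_forall _ _ _ _ FF near_al.
have key := @filterI _ _ FF _ _ near_s (@filterI _ _ FF _ _ near_ths near_als).
apply: (@filterS _ _ FF _ _ _ key) => -[[s' th'] al'] /= [hs [hth hal]].
move=> [[/= s01' _] Aal'].
apply: (@le_lt_trans _ _ (e / 2)); last by lra.
rewrite in_itv/= in s01; rewrite in_itv/= in s01'.
apply: (@waves_close m 0 s s' th th' al al' (e / 18) (e / 18)) => //.
- exact: mk_waveE.
- exact: mk_waveE.
- by move=> j jm; split; [exact: (hth (Ordinal jm))|exact: (hal (Ordinal jm))].
- by lra.
Qed.

(** The space is the continuous image of a product of compact sets, compact by Tychonoff's
    theorem. *)
Lemma compact_waves : (forall j, A j !=set0) -> (forall j, compact (A j)) ->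
  compact [set: waves A].
Proof.
move=> /waves_inhabited[x0 _] cA.
have -> : [set: waves A] = mk_wave x0 @` params.
  apply/esym/seteqP; split=> // x _.
  have [s [th [al [s01 th02 Aal xE]]]] := wavesE x.
  exists (s, th, al).
    by split => //; split => //= [|j]; rewrite in_itv/=.
  by apply: waves_inj => k; rewrite mk_waveE// xE.
apply: continuous_compact; first exact: mk_wave_continuous.
apply: compact_setX; last exact: (@tychonoff nat (fun=> R) A).
apply: compact_setX; first exact: segment_compact.
apply: (@tychonoff nat (fun=> R) (fun=> `[0, 2]%classic)) => _.
exact: segment_compact.
Qed.

(** Fixing angles and speeds and varying the radius gives a path; all these paths meet at the zero
    trajectory. *)
Lemma connected_waves : (forall j, A j !=set0) -> connected [set: waves A].
Proof.
move=> /[dup] /choice[al0 Aal0] /waves_inhabited[x0 _].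
pose P := [set q : (nat -> R) * (nat -> R) | forall j, A j (q.2 j)].
have -> : [set: waves A] =
    \bigcup_(q in P) ((fun s => mk_wave x0 (s, q.1, q.2)) @` `[0, 1]).
  apply/esym/seteqP; split=> // x _.
  have [s [th [al [s01 _ Aal xE]]]] := wavesE x.
  exists (th, al) => //; exists s; first by rewrite /= in_itv.
  by apply: waves_inj => k; rewrite mk_waveE// xE.
apply: bigcup_connected.
  exists (mk_wave x0 (0, al0, al0)) => -[th al] /= Aal; exists 0.
    by rewrite in_itv/= lexx ler01.
  by apply: waves_inj => k; rewrite !mk_waveE ?lexx ?ler01// /wave !mul0r.
move=> -[th al] Aal; apply: connected_continuous_connected.
  exact: segment_connected.
apply/subspace_continuousP => s /= s01.
apply/metricType_numDomainType.cvgrPdist_lt => e e0.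
rewrite near_withinE.
apply: filterS (nbhsx_ballx s _ (divr_gt0 e0 (ltr0n _ 10))).
move=> s' ss' s01'; apply: (@le_lt_trans _ _ (e / 2)); last by lra.
rewrite in_itv/= in s01; rewrite /= in_itv/= in s01'.
have e20 : 0 < e / 2 by rewrite divr_gt0.
have [m me] := exists_exp2_le e20.
apply: (@waves_close m 0 s s' th th al al (e / 10) 0) => //.
- exact: mk_waveE.
- exact: mk_waveE.
- exact: ltW.
- by move=> j _; rewrite !subrr normr0; split=> //; rewrite divr_ge0// ltW.
- by lra.
Qed.

End parametrization.

(** * Upper and lower bounds for the growth of separated sets *)

Section entropy.
Context {R : realType} (lam : R).
Let r := expR (- lam).
Hypothesis lam0 : 0 < lam.
Hypothesis r4 : r <= 1 / 4.
Let r0 : 0 < r. Proof. exact: expR_gt0. Qed.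

Let exprnE L : r ^+ L = expR (- (L%:R * lam)).
Proof. by rewrite -expRM_natl mulrN. Qed.

Let exp2nE L : 2 ^+ L = expR (L%:R * ln 2) :> R.
Proof. by rewrite expRM_natl lnK// posrE. Qed.

Definition speeds (act : pred nat) (j : nat) : set R :=
  if act j then cantor r else [set 0].

Variable act : pred nat.
Local Notation Y := (waves (speeds act)).

Let speeds0 j : speeds act j 0.
Proof.
by rewrite /speeds; case: ifP => // _; exact: (@cantor_cantor_pt R r [::]).
Qed.

Lemma speeds_neq0 j : speeds act j !=set0.
Proof. by exists 0. Qed.

Lemma compact_speeds j : compact (speeds act j).
Proof.
by rewrite /speeds; case: ifP => _; [exact: compact_cantor|exact: compact_set1].
Qed.

Let truncn_close (Q : nat) (t u : R) : 0 <= t -> 0 <= u ->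
  Num.truncn (t * Q.+1%:R) = Num.truncn (u * Q.+1%:R) -> `|t - u| <= Q.+1%:R^-1.
Proof.
move=> t0 u0 tu; have Q0 : 0 < Q.+1%:R :> R by rewrite ltr0n.
rewrite -[_^-1]mul1r ler_pdivlMr// -[X in _ * X](gtr0_norm Q0) -normrM mulrBl.
have := truncn_itv (mulr_ge0 t0 (ltW Q0)).
have := truncn_itv (mulr_ge0 u0 (ltW Q0)).
by rewrite tu -natr1 ler_norml => /andP[? ?] /andP[? ?]; lra.
Qed.

(** A trajectory is coded by the grid cells of its radius and of [m] initial angles, and by [L]
    Cantor digits for each of [d] speeds. Only the digit count will have to grow with [n]. *)
Lemma sep_shift_le (d m Q L n : nat) (e : R) :
  (forall j, (d <= j)%N -> ~~ act j) -> 0 <= e -> 2 / 2 ^+ m <= e ->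
  5 / Q.+1%:R + 4 * n%:R * (3 * r ^+ L) <= e ->
  (sep (@shift R (speeds act) 1) n e <=
    ((Q.+1 * 2).+1 ^ m.+1 * 2 ^ (L * d))%:R%:E)%E.
Proof.
move=> actd e0 me Qe.
(* The extra cell is for the endpoint [t = 2]. *)
pose q (t : R) : 'I_(Q.+1 * 2).+1 := inord (Num.truncn (t * Q.+1%:R)).
have qP t u : 0 <= t <= 2 -> 0 <= u <= 2 -> q t = q u -> `|t - u| <= Q.+1%:R^-1.
  have lt2 v : 0 <= v <= 2 -> (Num.truncn (v * Q.+1%:R) < (Q.+1 * 2).+1)%N.
    move=> /andP[v0 v2]; rewrite truncn_lt_nat ?mulr_ge0//.
    rewrite -[ltRHS]natr1 natrM mulrC ltr_pwDr// ler_wpM2l//.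
  move=> t02 u02 /(congr1 val); rewrite /= !inordK ?lt2//.
  by apply: truncn_close; [case/andP: t02|case/andP: u02].
have [code codeP] := cantor_code r0 r4 L.
have /choice[p pP] : forall x : Y, exists p : R * (nat -> R) * (nat -> R),
    [/\ 0 <= p.1.1 <= 1, forall j, 0 <= p.1.2 j <= 2,
      forall j, speeds act j (p.2 j) & sval x = wave p.1.1 p.1.2 p.2].
  by move=> x; have [s [th [al ?]]] := wavesE x; exists (s, th, al).
pose T := ('I_(Q.+1 * 2).+1 * {ffun 'I_m -> 'I_(Q.+1 * 2).+1} *
  {ffun 'I_d -> L.-tuple bool})%type.
pose cd x : T := (q (p x).1.1, [ffun j : 'I_m => q ((p x).1.2 j)],
   [ffun j : 'I_d => code ((p x).2 j)]).
have cT : #|{: T}| = ((Q.+1 * 2).+1 ^ m.+1 * 2 ^ (L * d))%N.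
  by rewrite !card_prod !card_ffun !card_ord card_tuple card_bool expnS expnM.
rewrite -cT; apply: (@sep_le_card _ _ _ _ _ _ cd) => x y [qs qth qal].
have [sx thx alx xE] := pP x; have [sy thy aly yE] := pP y.
apply: bowen_dist_le => // i iltn.
apply: (waves_close sx sy xE yE _ _ me (u := Q.+1%:R^-1) (v := 3 * r ^+ L)).
- by apply: qP => //; [case/andP: sx|case/andP: sy] => -> h /=; lra.
- move=> j jm; split.
    apply: qP => //.
    by have /ffunP/(_ (Ordinal jm)) := qth; rewrite !ffunE.
  have [jd|dj] := ltnP j d.
    have := alx j; have := aly j; rewrite /speeds; case: ifP => _.
      move=> h1 h2; apply: codeP => //.
      by have /ffunP/(_ (Ordinal jd)) := qal; rewrite !ffunE.
    by move=> -> ->; rewrite subrr normr0 mulr_ge0// exprn_ge0// ltW.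
  have := alx j; have := aly j; rewrite /speeds (negbTE (actd _ dj)) => -> ->.
  by rewrite subrr normr0 mulr_ge0// exprn_ge0// ltW.
(* Only times [i < n] occur, so [i + 1 <= n]. *)
- apply: le_trans Qe; rewrite lerD2l ler_wpM2r//.
    by rewrite mulr_ge0// exprn_ge0// ltW.
  by rewrite ler_wpM2l// ler_nat.
Qed.

(** In multiplicative form, [r ^- L <= z < r ^- (L + 1)]: this [L] is the number of Cantor digits
    visible at scale [1 / z]. *)
Let truncn_ln (z : R) : 1 <= z ->
  (Num.truncn (ln z / lam))%:R * lam <= ln z <
    (Num.truncn (ln z / lam)).+1%:R * lam.
Proof.
move=> z1; have /andP[h1 h2] := truncn_itv (divr_ge0 (ln_ge0 z1) (ltW lam0)).
by rewrite -ler_pdivlMr// h1 -ltr_pdivrMr.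
Qed.

Let exprn_r_le (z : R) : 0 < z -> exists M, r ^+ M <= z.
Proof.
move=> z0; have [z1|/ltW z1] := leP 1 z; first by exists 0%N; rewrite expr0.
have zV1 : 1 <= z^-1 by rewrite invf_ge1.
exists (Num.truncn (ln z^-1 / lam)).+1; rewrite exprnE.
have /andP[_ /ltW h] := truncn_ln zV1.
rewrite -[leRHS]lnK// ler_expR.
by have := @lnV R z; rewrite posrE => /(_ z0); lra.
Qed.

Lemma pol_growth_shift_le (d : nat) (e : R) :
  (forall j, (d <= j)%N -> ~~ act j) -> 0 < e ->
  (pol_growth (@shift R (speeds act) 1) e <= (d%:R * ln 2 / lam)%:E)%E.
Proof.
move=> actd e0; have [m me] := exists_exp2_le e0.
(* Half of [e] goes to the speeds, [12 n r ^ L <= 12 (e / 24)], and half to the radius and angles,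
   through [Q]. *)
have [M Me] := exprn_r_le (divr_gt0 e0 (ltr0n _ 24)).
pose Q := Num.truncn (10 / e).
have Qe : 5 / Q.+1%:R <= e / 2.
  rewrite ler_pdivrMr ?ltr0n//.
  have := truncnS_gt (10 / e); rewrite -/Q ltr_pdivrMr//; lra.
pose K := ((Q.+1 * 2).+1 ^ m.+1)%N.
have K0 : (0 < K)%N by rewrite expn_gt0.
apply: (@pol_growth_le _ _ _ _ _ (ln K%:R + M.+1%:R * (d%:R * ln 2))) => n n1.
have n0 : 0 < n%:R :> R by rewrite ltr0n ltnW.
have /truncn_ln : 1 <= n%:R :> R by rewrite ler1n ltnW.
set t := Num.truncn _ => /andP[tn /ltW nt].
have rt : n%:R * r ^+ t.+1 <= 1.
  by rewrite exprnE expRN -[n%:R]lnK// ler_pdivrMr ?expR_gt0// mul1r ler_expR.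
(* The [t + 1] digits resolve speeds to [1 / n]; the [M] further digits, independent of [n], gain
   the factor [e / 24]. *)
apply: (le_trans (@sep_shift_le d m Q (M + t.+1) n e actd (ltW e0) me _)).
  have : n%:R * r ^+ (M + t.+1) <= e / 24.
    rewrite exprD mulrCA -[leRHS]mulr1; apply: ler_pM => //.
      by rewrite exprn_ge0// ltW.
    by rewrite mulr_ge0 ?ler0n// exprn_ge0// ltW.
  move: Qe; rewrite mulrACA; move: (5 / _) (n%:R * _) => p q; lra.
rewrite lee_fin natrM -/K natrX exp2nE -[K%:R]lnK ?posrE ?ltr0n//.
rewrite -expRD ler_expR.
rewrite lnK ?posrE ?ltr0n// -addrA lerD2l natrM natrD.
have l2 : 0 <= d%:R * ln 2 :> R by rewrite mulr_ge0 ?ler0n// ln_ge0// ler1n.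
have : t%:R * (d%:R * ln 2) <= d%:R * ln 2 / lam * ln n%:R.
  rewrite -mulrA mulrC; apply: ler_wpM2l => //.
  by rewrite mulrC ler_pdivlMr.
rewrite -!natr1; lra.
Qed.

(** If [t < 1 / 2], the first multiple of [t] beyond 1/2 overshoots it by at most [t], hence stays
    below 1. For speeds [t] apart, [i] is a time when the angles are well apart. *)
Let mulrn_half (t : R) : 0 < t <= 1 -> exists i : nat,
  2^-1 <= i%:R * t <= 1 /\ i%:R <= (2 * t)^-1 + 1.
Proof.
move=> /andP[t0 t1]; have t20 : 0 < 2 * t by rewrite mulr_gt0.
have [th|th] := leP 2^-1 t.
  by exists 1%N; rewrite mul1r th t1 lerDr invr_ge0 ltW.
have tV0 : 0 <= (2 * t)^-1 by rewrite invr_ge0 ltW.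
have /andP[h1 h2] := truncn_itv tV0.
move: h1 h2; set k := Num.truncn _ => h1 h2.
have kS : k.+1%:R = k%:R + 1 :> R by rewrite -addn1 natrD.
exists k.+1; rewrite kS in h2 *; split; last by rewrite lerD2r.
have kt : k%:R * (2 * t) <= 1 by rewrite -ler_pdivlMr// mul1r.
have kt' : 1 < (k%:R + 1) * (2 * t) by rewrite -ltr_pdivrMr// mul1r.
lra.
Qed.

(** Take radius 1, zero initial angles, and all choices of [L]-digit Cantor speeds on the first [m]
    circles. Two choices differ by at least [r ^ L / 2] on some circle, so before time [n] the
    angles there are between a quarter and a half turn apart. *)
Lemma sep_shift_ge (m L n : nat) :
  (forall j, (j < m)%N -> act j) -> (r ^+ L)^-1 + 2 <= n%:R ->
  ((2 ^ (L * m))%:R%:E <= sep (@shift R (speeds act) 1) n (2^-1 ^+ m))%E.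
Proof.
move=> actm Ln; have [x0 _] := @waves_inhabited R (speeds act) speeds_neq0.
pose T := {ffun 'I_m -> L.-tuple bool}.
pose al (f : T) j := if insub j is Some j' then cantor_pt r (f j') else 0.
have alS f j : speeds act j (al f j).
  rewrite /al; case: insubP => [j' jm _|_]; last exact: speeds0.
  by rewrite /speeds actm//; exact: cantor_cantor_pt.
pose pt f := mk_wave x0 (1, fun=> 0, al f).
have ptE f : sval (pt f) = wave 1 (fun=> 0) (al f).
  by apply: mk_waveE => //; rewrite lexx ler01.
have -> : (2 ^ (L * m))%N = #|{: T}|.
  by rewrite card_ffun card_tuple card_bool card_ord expnM.
apply: (@sep_ge_card _ _ _ _ _ _ pt) => [|f g fg].
  by rewrite exprn_ge0// invr_ge0.
have /existsP[j fgj] : [exists j, f j != g j].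
  apply: contraNT fg; rewrite negb_exists => /forallP fg.
  by apply/eqP/ffunP => j; apply/eqP; rewrite -[_ == _]negbK.
have alE h : al h j = cantor_pt r (h j) by rewrite /al valK.
set t := `|al f j - al g j|.
have rL0 : 0 < r ^+ L by rewrite exprn_gt0.
have rLt : r ^+ L / 2 <= t.
  by rewrite /t !alE; apply: cantor_pt_apart; rewrite ?size_tuple.
have t0 : 0 < t by apply: lt_le_trans rLt; rewrite divr_gt0.
have t1 : t <= 1.
  have := @cantor_pt_itv _ _ r0 r4 (f j).
  have := @cantor_pt_itv _ _ r0 r4 (g j).
  by rewrite /t !alE ler_norml; lra.
have [|i [it in_]] := mulrn_half (t := t); first by rewrite t0.
have iltn : (i < n)%N.
  rewrite -(ltr_nat R); apply: lt_le_trans Ln; apply: le_lt_trans in_ _.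
  rewrite (@le_lt_trans _ _ ((r ^+ L)^-1 + 1))// ?ltrD2l ?ltr1n//.
  rewrite lerD2r lef_pV2 ?posrE//; last by rewrite mulr_gt0.
  lra.
have [|c oc] := @osc_apart R (i%:R * al f j) (i%:R * al g j).
  by rewrite -mulrBr normrM ger0_norm.
apply: lt_le_trans (le_bowen_dist _ _ _ iltn).
(* Coordinate 0 of the [i]-th iterate is time [i] of the trajectory, so the weight is [2 ^- j],
   strictly above [2 ^- m] as [j < m]. *)
apply: lt_le_trans (le_mdist_waves _ _ (nat_of_ord j, 0, c)).
rewrite !iter_shift1/= !ptE /wave/= !add0r !mul1r /weight/= addn0.
apply: (@lt_le_trans _ _ (2^-1 ^+ j)); last by rewrite ler_peMr// exprn_ge0.
by rewrite ltr_iXn2l// ?invr_gt0// invf_lt1// ltr1n.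
Qed.

Lemma pol_growth_shift_ge (m : nat) : (forall j, (j < m)%N -> act j) ->
  ((m%:R * ln 2 / lam)%:E <=
    pol_growth (@shift R (speeds act) 1) (2^-1 ^+ m))%E.
Proof.
(* [C] pays for rounding [L] down and for using [n / 2] in place of [n]; [n >= 4] gives
   [n / 2 + 2 <= n]. *)
move=> actm; pose C : R := m%:R * ln 2 * (ln 2 / lam + 1).
apply: (@pol_growth_ge _ _ _ _ _ C 4) => n n4.
have n0 : 0 < n%:R :> R by rewrite ltr0n (leq_trans _ n4).
have n4' : 4 <= n%:R :> R by rewrite ler_nat.
have /truncn_ln : 1 <= n%:R / 2 :> R by lra.
set L := Num.truncn _ => /andP[Ln nL].
apply: le_trans (@sep_shift_ge m L n actm _); last first.
  rewrite exprnE expRN invrK.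
  have : expR (L%:R * lam) <= n%:R / 2.
    by rewrite -[leRHS]lnK ?posrE ?divr_gt0// ler_expR.
  lra.
rewrite lee_fin natrX exp2nE ler_expR natrM.
have l2 : 0 <= m%:R * ln 2 :> R by rewrite mulr_ge0 ?ler0n// ln_ge0// ler1n.
have : ln n%:R / lam <= L%:R + 1 + ln 2 / lam.
  rewrite ler_pdivrMr// mulrDl divfK ?gt_eqF//.
  have LS : L.+1%:R = L%:R + 1 :> R by rewrite -addn1 natrD.
  by move: nL; rewrite ln_div ?posrE// LS; lra.
move=> /(ler_wpM2l l2); rewrite /C.
set p := _ / lam; set q := ln 2 / lam.
have -> : m%:R * ln 2 / lam * ln n%:R = m%:R * ln 2 * p by rewrite /p; ring.
lra.
Qed.

End entropy.

(** * Choice of the ratio and of the active circles *)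

Theorem theorem37 (R : realType) (a : \bar R) (ha : (0 <= a)%E) :
  exists (Y : metricType R) (g : Y -> Y),
    [/\ continuum Y, homeomorphism g & hpol g = a].
Proof.
suff [lam [act [lam0 r4 h]]] : exists lam (act : pred nat),
    [/\ 0 < lam, expR (- lam) <= 1 / 4
      & hpol (@shift R (speeds lam act) 1) = a].
  exists (waves (speeds lam act)), (shift 1); split=> //; last first.
    exact: homeomorphism_shift.
  have [x _] := waves_inhabited (@speeds_neq0 R lam act).
  split; first by exists x.
    by apply: compact_waves; [exact: speeds_neq0|exact: compact_speeds].
  by apply: connected_waves; exact: speeds_neq0.
have ln2_gt0 : 0 < ln 2 :> R by rewrite ln_gt0// ltr1n.
have expN_le (lam : R) : 2 * ln 2 <= lam -> expR (- lam) <= 1 / 4.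
  move=> h; rewrite expRN div1r lef_pV2 ?posrE ?expR_gt0//.
  have -> : 4 = expR (2 * ln 2) :> R by rewrite expRM_natl lnK ?posrE// -natrX.
  by rewrite ler_expR.
case: a ha => [a|_|//].
  rewrite lee_fin => a0.
  (* Taking [d > 2 a] makes [lam = d ln 2 / a] exceed [2 ln 2], that is, the ratio is below 1/4. For
     [a = 0] no circle is active. *)
  pose d := if a == 0 then 0%N else (Num.truncn (2 * a)).+1.
  have [lam [lam0 r4 adlam]] : exists lam : R,
      [/\ 0 < lam, expR (- lam) <= 1 / 4 & d%:R * ln 2 / lam = a].
    rewrite /d; have [->|aN0] := eqVneq a 0.
      exists (2 * ln 2); rewrite !mul0r.
      by split; [rewrite mulr_gt0|exact: expN_le|].
    have {}a0 : 0 < a by rewrite lt_neqAle eq_sym aN0.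
    have d2a := truncnS_gt (2 * a); set d' : R := (Num.truncn _).+1%:R in d2a *.
    exists (d' * ln 2 / a); split.
    - by rewrite divr_gt0// mulr_gt0// ltr0n.
    - by apply: expN_le; rewrite ler_pdivlMr// mulrAC ler_pM2r// ltW.
    - by rewrite invf_div mulrC divfK// mulf_neq0// gt_eqF// ltr0n.
  exists lam, (fun j => (j < d)%N); split => //; rewrite -adlam.
  apply/eqP; rewrite eq_le; apply/andP; split.
    apply: hpol_le => e e0; apply: pol_growth_shift_le => // j dj.
    by rewrite -leqNgt.
  apply: (@hpol_ge _ _ _ (2^-1 ^+ d)); first by rewrite exprn_gt0// invr_gt0.
  exact: pol_growth_shift_ge.
(* With ratio 1/4 each circle contributes [ln 2 / lam = 1 / 2], so the first [m > 2 t] circles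
   already give more than [t]. *)
exists (2 * ln 2), xpredT; split; [by rewrite mulr_gt0|exact: expN_le|].
apply: eq_infty => t; pose m := (Num.truncn (2 * t)).+1.
apply: (@hpol_ge _ _ _ (2^-1 ^+ m)); first by rewrite exprn_gt0// invr_gt0.
apply: le_trans (@pol_growth_shift_ge _ _ _ _ _ m _) => //; last exact: expN_le.
  rewrite lee_fin -mulf_div divff ?gt_eqF// mulr1 ler_pdivlMr//.
  by rewrite mulrC ltW// truncnS_gt.
by rewrite mulr_gt0.
Qed.
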